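(* Consider minimizing $f(x)=\frac{1}{Mn}\sum_{m\in[M],j\in[n]}f_{m,j}(x)$, $N=Mn$, over $\mathcal{K}\subseteq\mathbb{R}^d$, where $\mathcal{K}$ is convex and compact with diameter $D=\sup_{x,y\in\mathcal{K}}\|x-y\|$, and where all $f_{m,j}$ are convex and $L$-smooth on $\mathcal{K}$ with $\|\nabla f_{m,j}(x)\|_\infty\le G_\infty$ for all $x\in\mathcal{K}$, $m\in[M]$, $j\in[n]$. Run the Quantized Frank-Wolfe (QFW) algorithm described in the context with: $p_i=2^{i-1}$; $\mathcal{S}_{i,1}^m=\{f_{m,j}:j\in[n]\}$; $S_{i,k}=p_i/M$ for $i\ge1,k\ge2$; $\eta_{i,k}=2/(p_i+k)$; and the $s$-Partition Encoding Scheme with levels $s_{1,i,1}=\sqrt{dp_i^2/M}$, $s_{2,i,1}=\sqrt{dp_i^2}$, and $s_{1,i,k}=\sqrt{dp_i/M}$, $s_{2,i,k}=\sqrt{dp_i}$ for $k\ge2$. Then, to obtain an $\epsilon$-suboptimal solution (i.e. $\mathbb{E}[f(x_{T+1})]-\min_{\mathcal{K}}f\le\epsilon$), it suffices to run at most $T=\mathcal{O}(1/\epsilon)$ iterations, and the IFO complexity per worker is $$\mathcal{O}\left(\frac{N\ln(1/\epsilon)+1/\epsilon^2}{M}\right).$$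
   Context: $\|\cdot\|$ is the Euclidean norm, $[n]=\{1,\dots,n\}$. There are $M$ workers and a master; worker $m$ has access to the functions $f_{m,j}$, $j\in[n]$. A function is $L$-smooth on $\mathcal{K}$ if its gradient is $L$-Lipschitz on $\mathcal{K}$. The $\mathcal{O}(\cdot)$ is for small $\epsilon$, with hidden constants depending only on $L,D,G_\infty$. The IFO complexity per worker is the number of exact component-function gradients computed by one worker, where a round with $k=1$ costs $n$ and a round with $k\ge2$ costs (up to a constant factor) the nominal sample size $S_{i,k}=p_i/M$. $s$-Partition Encoding Scheme: for $g\in\mathbb{R}^d$ and each coordinate $i$, find $l_i\in\{0,\dots,s-1\}$ with $|g_i|/\|g\|_\infty\in[l_i/s,(l_i+1)/s]$ and let $b_i=l_i/s$ with probability $1-\frac{|g_i|}{\|g\|_\infty}s+l_i$, and $b_i=(l_i+1)/s$ with probability $\frac{|g_i|}{\|g\|_\infty}s-l_i$. The transmitted data are $\mathrm{sign}(g_i)b_i$ and $\|g\|_\infty$; the decoded vector $\phi'(g)$ has coordinates $\mathrm{sign}(g_i)b_i\|g\|_\infty$ (and $\phi'(0)=0$). QFW: starting from $x_1\in\mathcal{K}$, rounds $t=1,\dots,T$ are grouped in consecutive periods of lengths $p_1,p_2,\dots$; round $t$ corresponds to $(i,k)$ with $t=\sum_{j=1}^{i-1}p_j+k$, $1\le k\le p_i$, and $x_{i,k}=x_t$, $\eta_{i,k}=\eta_t$. In round $(i,k)$ each worker $m$ takes a collection $\mathcal{S}_{i,k}^m$ of its local functions; for $k\ge2$ it consists of $S_{i,k}$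 functions sampled uniformly at random (with replacement) from its $n$ functions. Writing $f_{\mathcal{S}}$ for the average of the functions in $\mathcal{S}$, the worker computes $g_{i,1}^m=\nabla f_{\mathcal{S}_{i,1}^m}(x_t)$ if $k=1$, and $g_{i,k}^m=\nabla f_{\mathcal{S}_{i,k}^m}(x_t)-\nabla f_{\mathcal{S}_{i,k}^m}(x_{t-1})$ if $k\ge2$, and sends it encoded with level $s_{1,i,k}$. The master decodes these to $\Phi_{1,i,k}'(g_{i,k}^m)$, forms $\tilde g_{i,k}=\frac1M\sum_{m=1}^M\Phi_{1,i,k}'(g_{i,k}^m)$, and broadcasts it encoded with level $s_{2,i,k}$; workers decode it to $\Phi_{2,i,k}'(\tilde g_{i,k})$ and set $\bar g_{i,1}=\Phi_{2,i,1}'(\tilde g_{i,1})$ if $k=1$, $\bar g_{i,k}=\Phi_{2,i,k}'(\tilde g_{i,k})+\bar g_{i,k-1}$ if $k\ge2$. Then $v_{i,k}\in\arg\min_{v\in\mathcal{K}}\langle v,\bar g_{i,k}\rangle$ and $x_{t+1}=x_t+\eta_{i,k}(v_{i,k}-x_t)$. All random choices are independent across coordinates, workers and rounds. In the algorithm, sample sizes and levels that are not integers are rounded up to the next positive integer. *)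

(* Defs.v *)
From HB Require Import structures.
From mathcomp Require Export all_boot all_order all_algebra.
From mathcomp Require Export all_classical all_reals all_analysis.

Set Implicit Arguments.
Unset Strict Implicit.
Unset Printing Implicit Defensive.

Export Order.TTheory GRing.Theory Num.Theory.
Export numFieldNormedType.Exports.

Local Open Scope classical_set_scope.
Local Open Scope ring_scope.

(** * Finitely supported probability distributions

    Every random choice of the algorithm has finitely many outcomes, so the law
    of a run is a finite list of (probability, outcome) pairs; an outcome may
    occur several times in the list, its probabilities then add up.  A fresh
    draw is independent of everything that was drawn before it, given the
    arguments it is called with. *)

Definition fdist (R : realType) (A : Type) := seq (R * A).

Definition dret (R : realType) (A : Type) (a : A) : fdist R A := [:: (1, a)].

Definition dbind (R : realType) (A B : Type) (mu : fdist R A)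
    (k : A -> fdist R B) : fdist R B :=
  flatten [seq [seq (w.1 * u.1, u.2) | u <- k w.2] | w <- mu].

Definition expectation (R : realType) (A : Type) (mu : fdist R A)
    (X : A -> R) : R :=
  \sum_(w <- mu) w.1 * X w.2.

Definition uniform (R : realType) (A : finType) : fdist R A :=
  [seq (#|A|%:R^-1, a) | a <- enum A].

Definition bernoulli_bit (R : realType) (p : R) : fdist R bool :=
  [:: (p, true); (1 - p, false)].

(* The product law: independent draws, one from each member of the list. *)
Fixpoint independent (R : realType) (A : Type) (mus : seq (fdist R A)) :
    fdist R (seq A) :=
  if mus is mu :: mus' then
    dbind mu (fun a => dbind (independent mus') (fun s => dret R (a :: s)))
  else dret R [::].

(** * Euclidean geometry and smoothness

    The library norm [`|x|] of a row vector is the sup norm; the Euclidean norm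
    is [enorm]. *)

Definition dotp (R : realType) (d : nat) (x y : 'rV[R]_d) : R :=
  \sum_(i < d) x 0 i * y 0 i.

Definition enorm (R : realType) (d : nat) (x : 'rV[R]_d) : R :=
  Num.sqrt (dotp x x).

Definition diameter (R : realType) (d : nat) (K : set 'rV[R]_d) : R :=
  sup [set enorm (p.1 - p.2) | p in K `*` K].

Definition grad (R : realType) (d : nat) (f : 'rV[R]_d -> R) (x : 'rV[R]_d) :
    'rV[R]_d :=
  \row_(i < d) 'D_(delta_mx 0 i) f x.

Definition smooth_on (R : realType) (d : nat) (L : R) (K : set 'rV[R]_d)
    (f : 'rV[R]_d -> R) : Prop :=
  (forall x, K x -> differentiable f x) /\
  (forall x y, K x -> K y ->
    enorm (grad f x - grad f y) <= L * enorm (x - y)).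

Definition argmin_linear (R : realType) (d : nat) (K : set 'rV[R]_d)
    (g v : 'rV[R]_d) : Prop :=
  K v /\ forall u, K u -> dotp v g <= dotp u g.

(** * The s-partition encoding scheme *)

(* A message holds the signed fractions [sign(g_i) b_i] and the scale. *)
Definition message (R : realType) (d : nat) := ('rV[R]_d * R)%type.

(* For 0 <= r <= 1, an l in {0, .., s - 1} with l/s <= r <= (l + 1)/s.  When r
   is an interior grid point there are two such l; both give the same law of
   the rounded fraction. *)
Definition bucket (R : realType) (s : nat) (r : R) : nat :=
  minn (Num.truncn (r * s%:R)) s.-1.

(* For g = 0 the ratios are 0 by the convention x / 0 = 0, every bit is false
   with probability 1, and the message decodes to 0. *)
Definition encode (R : realType) (d : nat) (s : nat) (g : 'rV[R]_d) :
    fdist R (message R d) :=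
  let r i := `|g 0 i| / `|g| in
  let l i := bucket s (r i) in
  dbind (independent
           [seq bernoulli_bit (r i * s%:R - (l i)%:R) | i <- enum 'I_d])
    (fun up => dret R
       (\row_(i < d) (Num.sg (g 0 i) * ((l i + nth false up i)%:R / s%:R)),
        `|g|)).

Definition decode (R : realType) (d : nat) (msg : message R d) : 'rV[R]_d :=
  msg.2 *: msg.1.

(** * Quantized Frank-Wolfe *)

(* Periods i and positions k inside a period are numbered from 1.  Sample sizes
   and levels are the nominal real values; the algorithm rounds them up. *)
Record qfw_params (R : realType) := QFWParams {
  period : nat -> nat;
  sample_size : nat -> nat -> R;
  step_size : nat -> nat -> R;
  level1 : nat -> nat -> R;
  level2 : nat -> nat -> R }.

Definition roundup (R : realType) (x : R) : nat := maxn 1 `|Num.ceil x|%N.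

Definition next_index (p : nat -> nat) (ik : nat * nat) : nat * nat :=
  if (ik.2 < p ik.1)%N then (ik.1, ik.2.+1) else (ik.1.+1, 1%N).

(* The pair (i, k) of round t >= 1. *)
Definition round_index (p : nat -> nat) (t : nat) : nat * nat :=
  iter t.-1 (next_index p) (1%N, 1%N).

(* After rounds 1, .., t: the point x_{t+1}, and the pairs (x_s, gbar_s) for
   s = t, .., 1, latest first. *)
Record transcript (R : realType) (d : nat) := Transcript {
  iterate : 'rV[R]_d;
  past : seq ('rV[R]_d * 'rV[R]_d) }.

(* An oracle picks a minimizer; its tie-breaking may depend on the whole
   transcript. *)
Definition oracle (R : realType) (d : nat) :=
  transcript R d -> 'rV[R]_d -> 'rV[R]_d.

Definition linear_minimization_oracle (R : realType) (d : nat)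
    (K : set 'rV[R]_d) (lmo : oracle R d) : Prop :=
  forall h g, argmin_linear K g (lmo h g).

Definition batch_average (R : realType) (d n : nat)
    (F : 'I_n -> 'rV[R]_d -> R) (js : seq 'I_n) (x : 'rV[R]_d) : R :=
  (\sum_(j <- js) F j x) / (size js)%:R.

Definition draw_batch (R : realType) (prm : qfw_params R) (n i k : nat) :
    fdist R (seq 'I_n) :=
  if k == 1%N then dret R (enum 'I_n)
  else independent (nseq (roundup (sample_size prm i k)) (uniform R 'I_n)).

Definition worker_round (R : realType) (prm : qfw_params R) (d n : nat)
    (F : 'I_n -> 'rV[R]_d -> R) (i k : nat) (x xprev : 'rV[R]_d) :
    fdist R (message R d) :=
  dbind (draw_batch prm n i k) (fun js =>
    let fS := batch_average F js in
    let g := if k == 1%N then grad fS x else grad fS x - grad fS xprev in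
    encode (roundup (level1 prm i k)) g).

(* At k = 1 neither the previous iterate nor the previous estimate is used, so
   the default of [head] is irrelevant. *)
Definition qfw_round (R : realType) (prm : qfw_params R) (d M n : nat)
    (F : 'I_M -> 'I_n -> 'rV[R]_d -> R) (lmo : oracle R d) (i k : nat)
    (h : transcript R d) : fdist R (transcript R d) :=
  let x := iterate h in
  let: (xprev, gprev) := head (x, 0) (past h) in
  dbind (independent
           [seq worker_round prm (F m) i k x xprev | m <- enum 'I_M])
    (fun msgs =>
      let gtilde := M%:R^-1 *: \sum_(msg <- msgs) decode msg in
      dbind (encode (roundup (level2 prm i k)) gtilde) (fun msg =>
        let gbar := if k == 1%N then decode msg else decode msg + gprev in
        let v := lmo h gbar in
        dret R (Transcript (x + step_size prm i k *: (v - x))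
                           ((x, gbar) :: past h)))).

(* The law of the transcript after T rounds. *)
Fixpoint qfw (R : realType) (prm : qfw_params R) (d M n : nat)
    (F : 'I_M -> 'I_n -> 'rV[R]_d -> R) (lmo : oracle R d) (x1 : 'rV[R]_d)
    (T : nat) : fdist R (transcript R d) :=
  if T is T'.+1 then
    dbind (qfw prm F lmo x1 T')
      (fun h => let: (i, k) := round_index (period prm) T in
                qfw_round prm F lmo i k h)
  else dret R (Transcript x1 [::]).

(* The n local gradients of a full batch, and two gradients (at x_t and at
   x_{t-1}) for each of the nominal number of sampled functions otherwise. *)
Definition ifo_complexity (R : realType) (prm : qfw_params R) (n T : nat) : R :=
  \sum_(1 <= t < T.+1)
    let: (i, k) := round_index (period prm) t in
    if k == 1%N then n%:R else 2 * sample_size prm i k.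

Definition objective (R : realType) (d M n : nat)
    (F : 'I_M -> 'I_n -> 'rV[R]_d -> R) (x : 'rV[R]_d) : R :=
  (\sum_(m < M) \sum_(j < n) F m j x) / (M * n)%:R.

Definition doubling_period (i : nat) : nat := (2 ^ i.-1)%N.

Definition doubling_params (R : realType) (d M : nat) : qfw_params R :=
  let p i : R := (doubling_period i)%:R in
  {| period := doubling_period;
     sample_size := fun i k => p i / M%:R;
     step_size := fun i k => 2 / (p i + k%:R);
     level1 := fun i k =>
       if k == 1%N then Num.sqrt (d%:R * p i ^+ 2 / M%:R)
       else Num.sqrt (d%:R * p i / M%:R);
     level2 := fun i k =>
       if k == 1%N then Num.sqrt (d%:R * p i ^+ 2)
       else Num.sqrt (d%:R * p i) |}.

(* Main.v *)
Require Import Defs.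
From mathcomp Require Import ring lra zify.

(** A run of the method is a Frank-Wolfe run with an inexact gradient, and the
    proof has two halves.

    The gradient estimate.  Every message of the protocol is an unbiased
    estimate: rounding to the [s]-grid keeps the mean and has variance at most
    [d |g|^2 / s^2] in terms of the sup norm ([encode_estimates]), and a batch
    sampled uniformly has the mean of all local functions
    ([draw_batch_estimates]).  Variances of conditionally unbiased stages add
    up, and averaging [M] independent workers divides the variance by [M]
    ([estimates_bind], [estimates_independent]).  The levels and batch sizes
    are tuned so that sampling, the upload and the broadcast each contribute
    [B^2 / q], where [q = p^2] for the first round of a period of length [p],
    [q = p] for the others, and [B] bounds what is encoded
    ([broadcast_estimates]).  In the first round [B] is the gradient bound; in
    a later round the encoded vector is a difference of gradients at
    consecutive iterates, so [B] is [L] times a step length, of order [1 / p].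
    Since the fresh noise has mean zero, the mean square error of the running
    estimate is at most the sum of these contributions: one of order [1 / p^2]
    and fewer than [p] of order [1 / p^3].  It is of order [1 / p^2] throughout
    the period ([qfw_estimate_error]).  The dimension is absorbed by the levels
    and never reaches the constants.

    The optimization.  Smoothness and convexity give the Frank-Wolfe inequality
    with an extra term, step size times diameter times the norm of the error
    ([frank_wolfe_step]).  Round [t] is at position [k = t + 1 - p] of its
    period, so the step size [2 / (p + k)] is the classical [2 / (t + 1)], and
    [p] is comparable to [t]; the extra term is of order [1 / t^2] like the
    curvature term, and the usual induction yields suboptimality [O(1 / t)]
    ([qfw_suboptimality]).

    After [T = O(1 / eps)] rounds there were [O(ln T)] periods, each costing one
    full batch, and the sampled batches cost at most [p / M <= T / M] per round
    ([ifo_complexity_le]). *)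

Set Implicit Arguments.
Unset Strict Implicit.
Unset Printing Implicit Defensive.

Local Open Scope classical_set_scope.
Local Open Scope ring_scope.

(** * Euclidean geometry *)

Definition sqnorm (R : realType) (d : nat) (x : 'rV[R]_d) : R := dotp x x.

Section Euclid.
Context {R : realType} {d : nat}.
Implicit Types (x y z : 'rV[R]_d) (a : R).

Lemma dotpC x y : dotp x y = dotp y x.
Proof. by apply: eq_bigr => i _; rewrite mulrC. Qed.

Lemma dotpDl x y z : dotp (x + y) z = dotp x z + dotp y z.
Proof. by rewrite -big_split; apply: eq_bigr => i _; rewrite !mxE mulrDl. Qed.

Lemma dotpZl a x y : dotp (a *: x) y = a * dotp x y.
Proof. by rewrite mulr_sumr; apply: eq_bigr => i _; rewrite !mxE mulrA. Qed.

Lemma dotpNl x y : dotp (- x) y = - dotp x y.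
Proof. by rewrite -scaleN1r dotpZl mulN1r. Qed.

Lemma dotpDr x y z : dotp z (x + y) = dotp z x + dotp z y.
Proof. by rewrite !(dotpC z) dotpDl. Qed.

Lemma dotpZr a x y : dotp x (a *: y) = a * dotp x y.
Proof. by rewrite !(dotpC x) dotpZl. Qed.

Lemma dotpNr x y : dotp x (- y) = - dotp x y.
Proof. by rewrite !(dotpC x) dotpNl. Qed.

Lemma dotpBl x y z : dotp (x - y) z = dotp x z - dotp y z.
Proof. by rewrite dotpDl dotpNl. Qed.

Lemma dotpBr x y z : dotp z (x - y) = dotp z x - dotp z y.
Proof. by rewrite dotpDr dotpNr. Qed.

Lemma dotp0r x : dotp x 0 = 0.
Proof. by rewrite -(scale0r 0) dotpZr mul0r. Qed.

Lemma dotp_sumr I (r : seq I) (F : I -> 'rV[R]_d) x :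
  dotp x (\sum_(i <- r) F i) = \sum_(i <- r) dotp x (F i).
Proof.
by elim: r => [|i r IH]; rewrite ?big_nil ?dotp0r// !big_cons dotpDr IH.
Qed.

Lemma sqnorm_ge0 x : 0 <= sqnorm x.
Proof. by apply: sumr_ge0 => i _; rewrite -expr2 sqr_ge0. Qed.

Lemma sqnormD x y : sqnorm (x + y) = sqnorm x + 2 * dotp x y + sqnorm y.
Proof. rewrite /sqnorm !dotpDl !dotpDr (dotpC y x); ring. Qed.

Lemma sqnormZ a x : sqnorm (a *: x) = a ^+ 2 * sqnorm x.
Proof. by rewrite /sqnorm dotpZl dotpZr mulrA expr2. Qed.

Lemma sqnormN x : sqnorm (- x) = sqnorm x.
Proof. by rewrite -scaleN1r sqnormZ sqrrN expr1n mul1r. Qed.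

Lemma sqnorm0 : sqnorm (0 : 'rV[R]_d) = 0. Proof. exact: dotp0r. Qed.

Lemma enorm_ge0 x : 0 <= enorm x. Proof. exact: sqrtr_ge0. Qed.

Lemma enorm_sqr x : enorm x ^+ 2 = sqnorm x.
Proof. by rewrite sqr_sqrtr ?sqnorm_ge0. Qed.

Lemma enorm0 : enorm (0 : 'rV[R]_d) = 0.
Proof. by rewrite /enorm dotp0r sqrtr0. Qed.

Lemma enormZ a x : enorm (a *: x) = `|a| * enorm x.
Proof.
by rewrite /enorm -/(sqnorm _) sqnormZ sqrtrM ?sqr_ge0// sqrtr_sqr.
Qed.

Lemma sqr_coord_le_sqnorm x i : x 0 i ^+ 2 <= sqnorm x.
Proof.
rewrite /sqnorm /dotp (bigD1 i)//= -expr2 lerDl.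
by apply: sumr_ge0 => j _; rewrite -expr2 sqr_ge0.
Qed.

Lemma enorm0_eq0 x : enorm x = 0 -> x = 0.
Proof.
move=> x0; apply/rowP => i; rewrite mxE; apply/eqP.
rewrite -sqrf_eq0 eq_le sqr_ge0 andbT.
by rewrite (le_trans (sqr_coord_le_sqnorm x i))// -enorm_sqr x0 expr0n.
Qed.

Lemma cauchy_schwarz x y : dotp x y <= enorm x * enorm y.
Proof.
have [x0|x0] := eqVneq (enorm x) 0.
  by rewrite (enorm0_eq0 x0) dotpC dotp0r enorm0 mul0r.
have [y0|y0] := eqVneq (enorm y) 0.
  by rewrite (enorm0_eq0 y0) dotp0r enorm0 mulr0.
have ab0 : 0 < enorm x * enorm y.
  by rewrite mulr_gt0// lt0r ?x0 ?y0 enorm_ge0.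
have := sqnorm_ge0 (enorm y *: x - enorm x *: y).
rewrite sqnormD sqnormN !sqnormZ dotpNr dotpZl dotpZr -!enorm_sqr => h.
rewrite -(ler_pM2l ab0); lra.
Qed.

Lemma le_enorm a x : 0 <= a -> (enorm x <= a) = (sqnorm x <= a ^+ 2).
Proof.
by move=> a0; rewrite -enorm_sqr ler_pXn2r// nnegrE ?enorm_ge0.
Qed.

Lemma enormD_le x y : enorm (x + y) <= enorm x + enorm y.
Proof.
rewrite le_enorm ?addr_ge0 ?enorm_ge0//.
have := cauchy_schwarz x y; rewrite sqnormD -!enorm_sqr; lra.
Qed.

Lemma enorm_sum_le I (r : seq I) (F : I -> 'rV[R]_d) :
  enorm (\sum_(i <- r) F i) <= \sum_(i <- r) enorm (F i).
Proof.
elim: r => [|i r IH]; rewrite ?big_nil ?enorm0// !big_cons.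
by rewrite (le_trans (enormD_le _ _))// lerD2l.
Qed.

Lemma norm_row_le x a : 0 <= a -> (forall i, `|x 0 i| <= a) -> `|x| <= a.
Proof.
move=> a0 xa; rewrite [leLHS]mx_normrE; apply/bigmax_leP; split => //= -[i j] _.
by rewrite (ord1 i).
Qed.

Lemma norm_coord_le x i : `|x 0 i| <= `|x|.
Proof.
rewrite [leRHS]mx_normrE; apply/bigmax_geP; right => /=; by exists (0, i).
Qed.

Lemma norm_le_enorm x : `|x| <= enorm x.
Proof.
apply: norm_row_le => [|i]; first exact: enorm_ge0.
by rewrite -sqrtr_sqr ler_wsqrtr// sqr_coord_le_sqnorm.
Qed.

Lemma sqnorm_le_norm x a : `|x| <= a -> sqnorm x <= d%:R * a ^+ 2.
Proof.
move=> xa; rewrite -[X in X%:R](card_ord d) -sum1_card natr_sum mulr_suml.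
apply: ler_sum => i _; rewrite mul1r -expr2 -[leLHS]ger0_norm ?sqr_ge0//.
have xia : `|x 0 i| <= a by exact: le_trans (norm_coord_le _ _) xa.
by rewrite normrX ler_pXn2r// nnegrE (le_trans _ xia).
Qed.

End Euclid.

(** * Finite laws and unbiased estimates *)

Definition mean (R : realType) (V : lmodType R) (A : Type) (mu : fdist R A)
    (X : A -> V) : V := \sum_(w <- mu) w.1 *: X w.2.

(** A list of weighted outcomes is a law only if its weights are nonnegative and
    add up to 1.  [P] is required of every listed outcome: this makes it an
    invariant of the run on which pointwise bounds may rely. *)
Definition law_on (R : realType) (A : Type) (P : A -> Prop) (mu : fdist R A) :=
  List.Forall (fun w => 0 <= w.1 /\ P w.2) mu /\
  expectation mu (fun=> 1) = 1.

Section Laws.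
Context {R : realType}.

Lemma mean_ret (V : lmodType R) (A : Type) (a : A) (X : A -> V) :
  mean (dret R a) X = X a.
Proof. by rewrite /mean big_seq1 scale1r. Qed.

Lemma mean_bind (V : lmodType R) (A B : Type) (mu : fdist R A)
    (k : A -> fdist R B) (X : B -> V) :
  mean (dbind mu k) X = mean mu (fun a => mean (k a) X).
Proof.
rewrite /mean /dbind big_flatten big_map; apply: eq_bigr => w _.
by rewrite big_map scaler_sumr; apply: eq_bigr => u _; rewrite scalerA.
Qed.

Lemma expectation_ret (A : Type) (a : A) (X : A -> R) :
  expectation (dret R a) X = X a.
Proof. exact: (mean_ret (V := R^o)). Qed.

Lemma expectation_bind (A B : Type) (mu : fdist R A)
    (k : A -> fdist R B) (X : B -> R) :
  expectation (dbind mu k) X = expectation mu (fun a => expectation (k a) X).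
Proof. exact: (mean_bind (V := R^o)). Qed.

Lemma dbindA (A B C : Type) (mu : fdist R A)
    (k : A -> fdist R B) (l : B -> fdist R C) :
  dbind mu (fun a => dbind (k a) l) = dbind (dbind mu k) l.
Proof.
rewrite /dbind; elim: mu => //= w mu ->.
rewrite map_cat flatten_cat; congr (_ ++ _).
elim: (k w.2) => //= u s IH; rewrite map_cat IH -map_comp; congr (_ ++ _).
by apply: eq_map => v /=; rewrite mulrA.
Qed.

Section OneLaw.
Context {A : Type} (mu : fdist R A) {P : A -> Prop}.
Hypothesis muP : law_on P mu.

Lemma law_imply (Q : A -> Prop) : (forall a, P a -> Q a) -> law_on Q mu.
Proof.
case: muP => muP0 mu1 PQ; split => //.
by apply: List.Forall_impl muP0 => w [w0 /PQ].
Qed.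

Lemma eq_mean (V : lmodType R) (X Y : A -> V) :
  (forall a, P a -> X a = Y a) -> mean mu X = mean mu Y.
Proof.
case: muP => muP0 _ XY; rewrite /mean; elim: muP0 => [|w s [_ Pw] _ IH].
  by rewrite !big_nil.
by rewrite !big_cons IH XY.
Qed.

Lemma le_expectation (X Y : A -> R) :
  (forall a, P a -> X a <= Y a) -> expectation mu X <= expectation mu Y.
Proof.
case: muP => muP0 _ XY; rewrite /expectation.
elim: muP0 => [|w s [w0 Pw] _ IH]; first by rewrite !big_nil.
by rewrite !big_cons lerD// ler_wpM2l// XY.
Qed.

Lemma mean_cst (V : lmodType R) (v : V) : mean mu (fun=> v) = v.
Proof.
rewrite /mean -scaler_suml -[RHS]scale1r; congr (_ *: _).
case: muP => _; rewrite /expectation => <-.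
by apply: eq_bigr => w _; rewrite mulr1.
Qed.

Lemma expectation_cst (c : R) : expectation mu (fun=> c) = c.
Proof. exact: (mean_cst (V := R^o)). Qed.

End OneLaw.

Lemma meanD (V : lmodType R) (A : Type) (mu : fdist R A) (X Y : A -> V) :
  mean mu (fun a => X a + Y a) = mean mu X + mean mu Y.
Proof. by rewrite -big_split; apply: eq_bigr => w _; rewrite scalerDr. Qed.

Lemma meanZ (V : lmodType R) (A : Type) (mu : fdist R A) (X : A -> V) (c : R) :
  mean mu (fun a => c *: X a) = c *: mean mu X.
Proof.
by rewrite scaler_sumr; apply: eq_bigr => w _; rewrite !scalerA mulrC.
Qed.

Lemma expectationD (A : Type) (mu : fdist R A) (X Y : A -> R) :
  expectation mu (fun a => X a + Y a) = expectation mu X + expectation mu Y.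
Proof. exact: (meanD (V := R^o)). Qed.

Lemma expectationZ (A : Type) (mu : fdist R A) (X : A -> R) (c : R) :
  expectation mu (fun a => c * X a) = c * expectation mu X.
Proof. exact: (meanZ (V := R^o)). Qed.

Lemma expectation_sum (A : Type) (mu : fdist R A) I (r : seq I)
    (X : I -> A -> R) :
  expectation mu (fun a => \sum_(i <- r) X i a)
  = \sum_(i <- r) expectation mu (X i).
Proof.
rewrite /expectation exchange_big; apply: eq_bigr => w _.
by rewrite mulr_sumr.
Qed.

Lemma expectation_dotp d (A : Type) (mu : fdist R A) (X : A -> 'rV[R]_d) c :
  expectation mu (fun a => dotp (X a) c) = dotp (mean mu X) c.
Proof.
rewrite dotpC dotp_sumr; apply: eq_bigr => w _.
by rewrite dotpZr dotpC.
Qed.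

Lemma mean_coord d (A : Type) (mu : fdist R A) (X : A -> 'rV[R]_d) i :
  mean mu X 0 i = expectation mu (fun a => X a 0 i).
Proof. by rewrite /mean summxE; apply: eq_bigr => w _; rewrite mxE. Qed.

Lemma law_ret (A : Type) (P : A -> Prop) a : P a -> law_on P (dret R a).
Proof.
move=> Pa; split; last by rewrite expectation_ret.
by constructor; first split.
Qed.

Lemma law_bind (A B : Type) (P : A -> Prop) (Q : B -> Prop) (mu : fdist R A)
    (k : A -> fdist R B) :
  law_on P mu -> (forall a, P a -> law_on Q (k a)) -> law_on Q (dbind mu k).
Proof.
move=> muP kQ; split; last first.
  rewrite expectation_bind -[RHS](expectation_cst muP 1).
  by apply: (eq_mean muP (V := R^o)) => a /kQ[].
case: muP => muP0 _; rewrite /dbind.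
elim: muP0 => [|w s [w0 Pw] _ IH]; first by constructor.
apply/List.Forall_app; split => //; case: (kQ _ Pw) => kQ0 _.
elim: kQ0 => [|u s' [u0 Qu] _ IH']; first by constructor.
by constructor => //; split => //=; exact: mulr_ge0.
Qed.

(** Bias-variance decomposition: the cross term is linear in the deviation of
    [X] from its mean, so its expectation is 0.  This identity is why the
    errors of successive and of independent draws add up in mean square. *)
Lemma expectation_sqnorm_shift d (A : Type) (P : A -> Prop) (mu : fdist R A)
    (X : A -> 'rV[R]_d) c : law_on P mu ->
  expectation mu (fun a => sqnorm (X a - c))
  = expectation mu (fun a => sqnorm (X a - mean mu X)) + sqnorm (mean mu X - c).
Proof.
move=> muP; set g := mean mu X.
have -> : (fun a => sqnorm (X a - c)) = (fun a => sqnorm (X a - g) +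
    (2 * dotp (X a) (g - c) + (sqnorm (g - c) - 2 * dotp g (g - c)))).
  apply/funext => a; rewrite -(subrKA g (X a) (- c)).
  by rewrite (sqnormD (X a - g)) dotpBl; ring.
rewrite !expectationD expectationZ expectation_dotp -/g !(expectation_cst muP).
ring.
Qed.

Definition estimates d (A : Type) (P : A -> Prop) (mu : fdist R A)
    (X : A -> 'rV[R]_d) (g : 'rV[R]_d) (V : R) : Prop :=
  [/\ law_on P mu, mean mu X = g &
      expectation mu (fun a => sqnorm (X a - g)) <= V].

Lemma estimates_ret d (A : Type) (P : A -> Prop) a (X : A -> 'rV[R]_d) :
  P a -> estimates P (dret R a) X (X a) 0.
Proof.
move=> Pa; split; [exact: law_ret|exact: mean_ret|].
by rewrite expectation_ret subrr sqnorm0.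
Qed.

(** Given the outcome of the first stage, the error of the second stage has
    mean 0, so the two errors are orthogonal in expectation. *)
Lemma estimates_bind d (A B : Type) (P : A -> Prop) (Q : B -> Prop)
    (mu : fdist R A) (k : A -> fdist R B) (X : B -> 'rV[R]_d)
    (Y : A -> 'rV[R]_d) g V W :
  estimates P mu Y g V -> (forall a, P a -> estimates Q (k a) X (Y a) W) ->
  estimates Q (dbind mu k) X g (W + V).
Proof.
move=> [muP mug muV] kW; split.
- by apply: law_bind muP _ => a /kW[].
- rewrite mean_bind -mug; apply: (eq_mean muP) => a /kW[] //.
- rewrite expectation_bind.
  apply: (@le_trans _ _ (expectation mu (fun a => W + sqnorm (Y a - g)))).
    apply: (le_expectation muP) => a /kW[kQ kY kV].
    by rewrite (expectation_sqnorm_shift _ _ kQ) kY lerD2r.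
  by rewrite expectationD (expectation_cst muP) lerD2l.
Qed.

Lemma estimatesZ d (A : Type) (P : A -> Prop) (mu : fdist R A)
    (X : A -> 'rV[R]_d) g V c :
  estimates P mu X g V ->
  estimates P mu (fun a => c *: X a) (c *: g) (c ^+ 2 * V).
Proof.
move=> [muP mug muV]; split => //; first by rewrite meanZ mug.
under [X in expectation _ X]funext => a do rewrite -scalerBr sqnormZ.
by rewrite expectationZ ler_wpM2l// sqr_ge0.
Qed.

Lemma eq_estimates d (A : Type) (P : A -> Prop) (mu : fdist R A)
    (X Y : A -> 'rV[R]_d) g V : (forall a, P a -> X a = Y a) ->
  estimates P mu X g V -> estimates P mu Y g V.
Proof.
move=> XY [muP mug muV]; split => //; first by rewrite -mug (eq_mean muP XY).
apply: le_trans muV; apply: (le_expectation muP) => a Pa.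
by rewrite XY.
Qed.

Lemma estimates_weaken d (A : Type) (P Q : A -> Prop) (mu : fdist R A)
    (X : A -> 'rV[R]_d) g V W : (forall a, P a -> Q a) -> V <= W ->
  estimates P mu X g V -> estimates Q mu X g W.
Proof.
move=> PQ VW [muP mug muV]; split => //; first exact: law_imply PQ.
exact: le_trans muV VW.
Qed.

(** The errors of independent draws are centred, hence orthogonal in
    expectation.  The sup norm of the sum is part of the support because it
    scales the quantization error when an average is encoded again. *)
Lemma estimates_independent d (A : Type) I (P : A -> Prop) (r : seq I)
    (mu : I -> fdist R A) (X : A -> 'rV[R]_d) (g : I -> 'rV[R]_d) (V B : R) :
  (forall i, estimates P (mu i) X (g i) V) ->
  (forall a, P a -> `|X a| <= B) ->
  estimates (fun s => size s = size r /\
                      `|\sum_(a <- s) X a| <= (size r)%:R * B)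
    (independent [seq mu i | i <- r])
    (fun s => \sum_(a <- s) X a) (\sum_(i <- r) g i) ((size r)%:R * V).
Proof.
move=> muV PB; elim: r => [|i r IH] /=.
  split; last by rewrite expectation_ret !big_nil subrr sqnorm0 mul0r.
    by apply: law_ret; rewrite big_nil normr0 mul0r.
  by rewrite mean_ret !big_nil.
rewrite big_cons -natr1 [X in estimates _ _ _ _ X]mulrDl mul1r.
have sV (a : A) : P a -> estimates (fun s => size s = (size r).+1 /\
      `|\sum_(a <- s) X a| <= ((size r)%:R + 1) * B)
    (dbind (independent [seq mu i | i <- r]) (fun s => dret R (a :: s)))
    (fun s => \sum_(a <- s) X a) (X a + \sum_(i <- r) g i) ((size r)%:R * V).
  move=> Pa; case: IH => sP sg sV; split.
  - apply: law_bind sP _ => s [ss sB]; apply: law_ret.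
    split; first by rewrite /= ss.
    rewrite big_cons mulrDl mul1r addrC (le_trans (ler_normD _ _))// lerD//.
    exact: PB.
  - rewrite mean_bind.
    under [X in mean _ X]funext => s do rewrite mean_ret big_cons.
    by rewrite meanD (mean_cst sP) sg.
  - rewrite expectation_bind.
    under [X in expectation _ X]funext => s do rewrite expectation_ret big_cons
      opprD addrACA subrr add0r.
    exact: sV.
apply: (estimates_bind (P := P) (Y := fun a => X a + \sum_(i <- r) g i) _ sV).
have [muP mug mV] := muV i; split => //.
  by rewrite meanD (mean_cst muP) mug.
by under [X in expectation _ X]funext => s do rewrite opprD addrACA subrr addr0.
Qed.

Lemma law_independent (A : Type) (P : A -> Prop) I (r : seq I)
    (mu : I -> fdist R A) :
  (forall i, law_on P (mu i)) ->
  law_on (fun s => size s = size r) (independent [seq mu i | i <- r]).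
Proof.
move=> muP; elim: r => [|i r IH] /=; first exact: law_ret.
apply: law_bind (muP i) _ => a _; apply: law_bind IH _ => s ss.
by apply: law_ret; rewrite /= ss.
Qed.

(** The coordinates of a product law have the factors as marginals.  The squared
    norm is a sum over coordinates, so the marginals determine the variance of
    an encoding. *)
Lemma expectation_independent_nth (A : Type) (P : A -> Prop) (a0 : A)
    (I : Type) (i0 : I) (r : seq I) (mu : I -> fdist R A) (phi : A -> R)
    (j : nat) :
  (forall i, law_on P (mu i)) -> (j < size r)%N ->
  expectation (independent [seq mu i | i <- r]) (fun s => phi (nth a0 s j))
  = expectation (mu (nth i0 r j)) phi.
Proof.
move=> muP; elim: r j => [|i r IH] [|j] //= jr; rewrite expectation_bind.
  congr expectation; apply/funext => a; rewrite expectation_bind.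
  under [X in expectation _ X]funext => s do rewrite expectation_ret /=.
  by rewrite (expectation_cst (law_independent _ muP)).
rewrite -(IH j)//.
under [X in expectation _ X]funext => a.
  rewrite expectation_bind.
  under [X in expectation _ X]funext => s do rewrite expectation_ret /=.
  over.
by rewrite (expectation_cst (muP i)).
Qed.

End Laws.

(** * The encoding scheme *)

Section Encoding.
Context {R : realType}.

Lemma bucketP (s : nat) (r : R) : (0 < s)%N -> 0 <= r <= 1 ->
  (bucket s r)%:R <= r * s%:R <= (bucket s r)%:R + 1 /\ (bucket s r < s)%N.
Proof.
move=> s0 /andP[r0 r1]; have rs0 : 0 <= r * s%:R by rewrite mulr_ge0.
have /andP[t1 t2] := truncn_itv rs0.
have rs : r * s%:R <= s%:R by rewrite ler_piMl.
rewrite /bucket; have [ts|st] := leqP (Num.truncn (r * s%:R)) s.-1.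
  by rewrite t1 /= natr1 (ltW t2) -[X in (_ < X)%N](prednK s0) ltnS ts.
rewrite natr1 (prednK s0) rs andbT; split => //.
by apply: le_trans t1; rewrite ler_nat ltnW.
Qed.

Lemma law_bernoulli (p : R) : 0 <= p <= 1 ->
  law_on (fun=> True) (bernoulli_bit p).
Proof.
move=> /andP[p0 p1]; split; last first.
  by rewrite /expectation big_cons big_seq1 /=; ring.
constructor; first by split.
by constructor; first by split; rewrite //= subr_ge0.
Qed.

(** Each coordinate is rounded to one of two neighbours in a grid of mesh
    [|g| / s], with probabilities that keep its mean, so it contributes at most
    the squared mesh.  The decoded fractions do not exceed 1, hence decoding
    does not increase the sup norm. *)
Lemma encode_estimates d (s : nat) (g : 'rV[R]_d) : (0 < s)%N ->
  estimates (fun msg => `|decode msg| <= `|g|) (encode s g) (@decode R d) g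
    (d%:R / s%:R ^+ 2 * `|g| ^+ 2).
Proof.
move=> s0; pose r i := `|g 0 i| / `|g|; pose l i := bucket s (r i).
have s0R : s%:R != 0 :> R by rewrite pnatr_eq0 -lt0n.
have gr i : `|g| * r i = `|g 0 i|.
  have [g0|g0] := eqVneq `|g| 0; last by rewrite /r mulrC divfK.
  rewrite g0 mul0r; apply/esym/eqP.
  by rewrite -normr_le0 normr_id -g0 norm_coord_le.
have r01 i : 0 <= r i <= 1.
  rewrite /r divr_ge0//=; have [g0|g0] := eqVneq `|g| 0.
    by rewrite g0 invr0 mulr0.
  by rewrite ler_pdivrMr ?lt0r ?g0 ?normr_ge0// mul1r norm_coord_le.
have lP i := bucketP s0 (r01 i).
pose p i := r i * s%:R - (l i)%:R.
have p01 i : 0 <= p i <= 1.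
  by have [/andP[? ?] _] := lP i; rewrite subr_ge0 lerBlDl; apply/andP.
pose phi i (b : bool) : R := `|g| * (Num.sg (g 0 i) * ((l i + b)%:R / s%:R)).
have phiE i b : phi i b = g 0 i + `|g| * Num.sg (g 0 i) * (b%:R - p i) / s%:R.
  (* Up to sign, the error is the grid mesh times a centred Bernoulli bit. *)
  have := numEsg (g 0 i); rewrite -gr /phi; set sg := Num.sg _ => ->.
  by rewrite /p natrD; field.
pose bits := independent [seq bernoulli_bit (p i) | i <- enum 'I_d].
have bitsP : law_on (fun s => size s = size (enum 'I_d)) bits.
  by apply: (@law_independent _ _ (fun=> True)) => i; exact: law_bernoulli.
have marginal (i : 'I_d) (psi : bool -> R) :
  expectation bits (fun up => psi (nth false up i))
  = p i * psi true + (1 - p i) * psi false.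
  rewrite (@expectation_independent_nth _ _ (fun=> True) _ _ i); first last.
    by rewrite size_enum_ord.
    by move=> j; exact: law_bernoulli.
  by rewrite nth_ord_enum /expectation big_cons big_seq1.
pose msg up : message R d :=
  (\row_(i < d) (Num.sg (g 0 i) * ((l i + nth false up i)%:R / s%:R)), `|g|).
rewrite -[encode s g]/(dbind bits (fun up => dret R (msg up))).
have decodeE up i : decode (msg up) 0 i = phi i (nth false up i).
  by rewrite !mxE.
split.
- apply: law_bind bitsP _ => up _; apply: law_ret.
  apply: norm_row_le => // i; rewrite decodeE 2!normrM normr_id ler_piMr//.
  apply: mulr_ile1; rewrite ?normr_ge0//.
    by rewrite normr_sg lern1 leq_b1.
  rewrite ger0_norm ?divr_ge0// ler_pdivrMr ?ltr0n// mul1r ler_nat.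
  have [_ ls] := lP i; rewrite -/(l i) in ls.
  by case: (nth _ _ _); rewrite ?addn1 ?addn0// ltnW.
- rewrite mean_bind; apply/rowP => i; rewrite mean_coord.
  under [X in expectation _ X]funext => up do rewrite mean_ret decodeE.
  by rewrite marginal !phiE /=; field; exact: s0R.
- rewrite expectation_bind.
  under [X in expectation _ X]funext => up do rewrite expectation_ret.
  rewrite expectation_sum.
  under eq_bigr => i _.
    under [X in expectation _ X]funext => up do rewrite !mxE -/(phi i _).
    rewrite (marginal i (fun b => (phi i b - g 0 i) * (phi i b - g 0 i))) !phiE.
    over.
  rewrite /= -[X in X%:R / _](card_ord d) -sum1_card natr_sum !mulr_suml.
  apply: ler_sum => i _.
  set sg := Num.sg _; set a := g 0 i.
  have sg1 : sg ^+ 2 <= 1 by rewrite /sg sqr_sg lern1 leq_b1.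
  have /andP[p0 p1] := p01 i.
  rewrite [leLHS](_ : _ = (`|g| / s%:R) ^+ 2 * (sg ^+ 2 * (p i * (1 - p i))));
    last by field; exact: s0R.
  rewrite [leRHS](_ : _ = (`|g| / s%:R) ^+ 2 * 1); last by field; exact: s0R.
  have q0 : 0 <= 1 - p i by rewrite subr_ge0.
  have q1 : 1 - p i <= 1 by rewrite gerBl.
  rewrite ler_wpM2l ?sqr_ge0//; apply: mulr_ile1; rewrite ?sqr_ge0 ?mulr_ge0//.
  exact: mulr_ile1.
Qed.

Lemma roundup_gt0 (x : R) : (0 < roundup x)%N.
Proof. by rewrite leq_max. Qed.

Lemma roundup_ge (x : R) : x <= (roundup x)%:R.
Proof.
have [x0|x0] := leP x 0; first by rewrite (le_trans x0).
apply: le_trans (ceil_ge x) _; rewrite /roundup.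
have c0 : 0 <= Num.ceil x by rewrite ceil_ge0 (lt_trans _ x0)// ltrN10.
by rewrite -[X in X%:~R]gez0_abs// -pmulrn ler_nat leq_maxr.
Qed.

(** Rounding a level up only lowers the variance factor; it also keeps the level
    positive in dimension 0. *)
Lemma level_variance (d : nat) (q : R) : 0 < q ->
  d%:R / (roundup (Num.sqrt (d%:R * q)))%:R ^+ 2 <= q^-1.
Proof.
move=> q0; set s := roundup _.
have s0 : 0 < s%:R :> R by rewrite ltr0n roundup_gt0.
rewrite ler_pdivrMr ?exprn_gt0// mulrC ler_pdivlMr//.
rewrite -[leLHS]sqr_sqrtr ?mulr_ge0 ?(ltW q0)//.
by rewrite ler_pXn2r ?nnegrE ?sqrtr_ge0 ?(ltW s0)// roundup_ge.
Qed.

End Encoding.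

(** * Smooth convex functions *)

Section Smooth.
Context {R : realType} {d : nat}.
Implicit Types (f : 'rV[R]_d -> R) (x v w : 'rV[R]_d).

Lemma derive_grad f x w : differentiable f x -> 'D_w f x = dotp (grad f x) w.
Proof.
move=> df; rewrite deriveE// {1}(row_sum_delta w) linear_sum.
apply: eq_bigr => i _; rewrite linearZ mxE deriveE//.
exact: mulrC.
Qed.

Lemma is_derive_line f x w s : differentiable f (x + s *: w) ->
  is_derive s (1 : R) (fun s => f (x + s *: w))
    (dotp (grad f (x + s *: w)) w).
Proof.
move=> df.
have E : (fun h : R => h^-1 *:
      (((fun s => f (x + s *: w)) \o shift s) (h *: 1) - f (x + s *: w))) =
    (fun h : R => h^-1 *:
      ((f \o shift (x + s *: w)) (h *: w) - f (x + s *: w))).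
  apply/funext => h; congr (_ *: (f _ - _)).
  by rewrite /= -[h *: 1]/(h * 1) mulr1 scalerDl addrCA.
have dw : derivable f (x + s *: w) w by exact: diff_derivable.
apply: DeriveDef; first by rewrite /derivable E.
by rewrite -derive_grad// /derive E.
Qed.

Lemma convex_set_segment (K : set 'rV[R]_d) x y t :
  @convex_set R 'rV[R]_d K -> K x -> K y -> 0 <= t <= 1 -> K (x + t *: (y - x)).
Proof.
move=> cK Kx Ky /andP[t0 t1].
have := cK y x (Itv01 t0 t1) (mem_set Ky) (mem_set Kx).
move=> /set_mem; congr K.
rewrite -[LHS]/(t *: y + (1 - t) *: x) scalerBl scale1r scalerBr.
by rewrite addrC addrAC addrA.
Qed.

(** Convexity at points written as a base point plus a step, the form in which
    iterates are produced. *)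
Definition convex_along (K : set 'rV[R]_d) f := forall x y t,
  K x -> K y -> 0 <= t <= 1 -> f (x + t *: (y - x)) <= f x + t * (f y - f x).

Lemma convex_function_along (K : set 'rV[R]_d) f :
  @convex_function R 'rV[R]_d K f -> convex_along K f.
Proof.
move=> cf x y t Kx Ky /andP[t0 t1].
have := cf (Itv01 t0 t1) y x (mem_set Ky) (mem_set Kx).
rewrite -[X in f X]/(t *: y + (1 - t) *: x) -[leRHS]/(t * f y + (1 - t) * f x).
rewrite scalerBl scale1r scalerBr addrC addrAC -addrA => h.
by apply: le_trans h _; rewrite le_eqVlt; apply/orP; left; apply/eqP; ring.
Qed.

(** By the mean value theorem the increment of [f] is [t] times a directional
    derivative at a point of the segment at distance at most [t |y - x|] from
    [x].  This gives [L] where integration would give [L / 2], which only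
    affects constants. *)
Lemma smooth_segment (K : set 'rV[R]_d) L f x y t :
  @convex_set R 'rV[R]_d K -> 0 <= L -> smooth_on L K f -> K x -> K y ->
  0 <= t <= 1 ->
  `|f (x + t *: (y - x)) - f x - t * dotp (grad f x) (y - x)|
    <= L * t ^+ 2 * sqnorm (y - x).
Proof.
move=> cK L0 [df Lf] Kx Ky t01; have /andP[t0 t1] := t01.
set w := y - x.
have Kseg s : 0 <= s <= t -> K (x + s *: w).
  move=> /andP[s0 st].
  by apply: convex_set_segment; rewrite // s0 (le_trans st).
have dline s : 0 <= s <= t ->
    is_derive s (1 : R) (fun s => f (x + s *: w))
      (dotp (grad f (x + s *: w)) w).
  by move=> /Kseg/df; exact: is_derive_line.
have [||c] := @MVT_segment R (fun s => f (x + s *: w))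
    (fun s => dotp (grad f (x + s *: w)) w) 0 t t0.
- by move=> s; rewrite in_itv/= => /andP[s0 st]; apply: dline; rewrite !ltW.
- apply: derivable_within_continuous => s; rewrite in_itv/= => st.
  by have [] := dline s st.
rewrite in_itv/= => ct; rewrite scale0r addr0 subr0 => ->.
rewrite mulrC -mulrBr.
have /andP[c0 _] := ct; rewrite -dotpBl normrM ger0_norm//.
have /andP[_ clet] := ct.
have ew := enorm_ge0 w.
have CS (a b : 'rV[R]_d) : `|dotp a b| <= enorm a * enorm b :> R.
  rewrite ler_norml cauchy_schwarz andbT lerNl -dotpNl.
  by rewrite (le_trans (cauchy_schwarz _ _))// -scaleN1r enormZ normrN1 mul1r.
rewrite [leRHS](_ : _ = t * (L * (t * enorm w) * enorm w)); last first.
  by rewrite -enorm_sqr; ring.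
rewrite ler_wpM2l// (le_trans (CS _ _))// ler_wpM2r//.
rewrite (le_trans (Lf _ _ (Kseg _ ct) Kx))// ler_wpM2l//.
by rewrite addrAC subrr add0r enormZ ger0_norm// ler_wpM2r.
Qed.

(** Convexity bounds the difference quotients of [f] along the segment by
    [f y - f x], and by smoothness the quotient at [t] is within
    [L t |y - x|^2] of the directional derivative; then [t] tends to 0. *)
Lemma convex_gradient_le (K : set 'rV[R]_d) L f x y :
  @convex_set R 'rV[R]_d K -> 0 <= L -> smooth_on L K f -> convex_along K f ->
  K x -> K y -> dotp (grad f x) (y - x) <= f y - f x.
Proof.
move=> cK L0 Lf cf Kx Ky; set q := L * sqnorm (y - x).
have q0 : 0 <= q by rewrite mulr_ge0 ?sqnorm_ge0.
apply/ler_addgt0Pr => e e0.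
pose t := Num.min 1 (e / (q + 1)).
have q1 : 0 < q + 1 by rewrite ltr_wpDl.
have t0 : 0 < t by rewrite lt_min ltr01 divr_gt0.
have t1 : t <= 1 by rewrite ge_min lexx.
have tq : t * q <= e.
  apply: (@le_trans _ _ (e / (q + 1) * q)).
    by rewrite ler_wpM2r// ge_min lexx orbT.
  by rewrite mulrAC ler_pdivrMr// ler_wpM2l ?(ltW e0)// lerDl.
have t01 : 0 <= t <= 1 by rewrite (ltW t0).
have := cf x y t Kx Ky t01.
have := smooth_segment cK L0 Lf Kx Ky t01; rewrite ler_norml => /andP[h _] h'.
rewrite -(ler_pM2l t0).
have : t * (t * q) <= t * e by rewrite ler_pM2l.
rewrite /q; lra.
Qed.

Lemma differentiable_batch_sum n (F : 'I_n -> 'rV[R]_d -> R) js x :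
  (forall j, differentiable (F j) x) ->
  differentiable (fun x => \sum_(j <- js) F j x) x /\
  grad (fun x => \sum_(j <- js) F j x) x = \sum_(j <- js) grad (F j) x.
Proof.
move=> dF; elim: js => [|j js [IHd IHg]].
  rewrite (_ : (fun x => _) = cst 0); last first.
    by apply/funext => y; rewrite big_nil.
  split; first exact: differentiable_cst.
  by apply/rowP => i; rewrite big_nil !mxE derive_cst.
rewrite (_ : (fun x => _) = F j + (fun x => \sum_(j <- js) F j x)); last first.
  by apply/funext => y; rewrite big_cons.
split; first exact: differentiableD.
rewrite big_cons -IHg; apply/rowP => i; rewrite !mxE deriveD//.
all: exact: diff_derivable.
Qed.

Lemma differentiable_batch_average n (F : 'I_n -> 'rV[R]_d -> R) js x :
  (forall j, differentiable (F j) x) ->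
  differentiable (batch_average F js) x /\
  grad (batch_average F js) x = (size js)%:R^-1 *: \sum_(j <- js) grad (F j) x.
Proof.
move=> /(differentiable_batch_sum js)[df <-].
rewrite (_ : batch_average F js =
    (size js)%:R^-1 \*: (fun x => \sum_(j <- js) F j x)); last first.
  by apply/funext => y; rewrite /batch_average mulrC.
split; first exact: differentiableZ.
by apply/rowP => i; rewrite !mxE deriveZ//; exact: diff_derivable.
Qed.

Lemma smooth_batch_average n (F : 'I_n -> 'rV[R]_d -> R) js K L :
  (0 < size js)%N -> (forall j, smooth_on L K (F j)) ->
  smooth_on L K (batch_average F js).
Proof.
move=> js0 LF; have dF x j : K x -> differentiable (F j) x.
  by case: (LF j) => + _; apply.
split=> [x Kx|x y Kx Ky].
  by have [] := differentiable_batch_average js (fun j => dF x j Kx).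
have [_ ->] := differentiable_batch_average js (fun j => dF x j Kx).
have [_ ->] := differentiable_batch_average js (fun j => dF y j Ky).
rewrite -scalerBr -sumrB enormZ ger0_norm ?invr_ge0//.
rewrite mulrC ler_pdivrMr ?ltr0n//.
rewrite (le_trans (enorm_sum_le _ _))//.
rewrite -sum1_size natr_sum mulr_sumr; apply: ler_sum => j _.
by rewrite mulr1; case: (LF j) => _; apply.
Qed.

Lemma convex_batch_average n (F : 'I_n -> 'rV[R]_d -> R) js K :
  (forall j, convex_along K (F j)) -> convex_along K (batch_average F js).
Proof.
move=> cF x y t Kx Ky t01; rewrite /batch_average -mulrBl mulrA -mulrDl.
rewrite ler_wpM2r ?invr_ge0// -sumrB mulr_sumr -big_split /=.
by apply: ler_sum => j _; exact: cF.
Qed.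

(** The objective is an average of averages, so smoothness, convexity and the
    gradient formula all transfer from one closure property each. *)
Lemma objectiveE M n (F : 'I_M -> 'I_n -> 'rV[R]_d -> R) :
  objective F =
  batch_average (fun m => batch_average (F m) (enum 'I_n)) (enum 'I_M).
Proof.
apply/funext => x; rewrite /objective /batch_average !size_enum_ord big_enum /=.
rewrite natrM invfM mulrA mulrAC; congr (_ / _).
by rewrite mulr_suml; apply: eq_bigr => m _; rewrite big_enum.
Qed.

Lemma enorm_le_diameter (K : set 'rV[R]_d) x y :
  compact K -> K x -> K y -> enorm (x - y) <= diameter K.
Proof.
move=> /compact_bounded[B [_ KB]] Kx Ky; apply: ub_le_sup; last first.
  by exists (x, y).
have {}KB z : K z -> `|z| <= `|B| + 1.
  by apply: KB; rewrite (le_lt_trans (ler_norm B))// ltrDl.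
exists (Num.sqrt (d%:R * ((`|B| + 1) + (`|B| + 1)) ^+ 2)).
move=> _ [[u v] /= [Ku Kv] <-].
rewrite ler_wsqrtr//; apply: sqnorm_le_norm.
by rewrite (le_trans (ler_normB _ _))// lerD// KB.
Qed.

End Smooth.

(** * One communication round *)

Section Rounds.
Context {R : realType} {d : nat}.

(** The variance is at most the second moment. *)
Lemma uniform_estimates n (G : 'I_n -> 'rV[R]_d) B : (0 < n)%N ->
  (forall j, enorm (G j) <= B) ->
  estimates (fun=> True) (uniform R 'I_n) G (n%:R^-1 *: \sum_j G j) (B ^+ 2).
Proof.
move=> n0 GB; have n0R : n%:R != 0 :> R by rewrite pnatr_eq0 -lt0n.
have unif : law_on (fun=> True) (uniform R 'I_n).
  rewrite /uniform; split.
    elim: (enum 'I_n) => [|j s IH]; first by constructor.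
    by constructor => //; split => //=; rewrite invr_ge0.
  rewrite /expectation big_map big_enum /= -mulr_suml sumr_const card_ord.
  by rewrite mulr1 -[LHS]mulr_natl divff.
have ug : mean (uniform R 'I_n) G = n%:R^-1 *: \sum_j G j.
  by rewrite /mean /uniform big_map big_enum /= card_ord scaler_sumr.
split => //; rewrite -ug.
have B0 : 0 <= B by rewrite (le_trans (enorm_ge0 _) (GB (Ordinal n0))).
apply: (@le_trans _ _
    (expectation (uniform R 'I_n) (fun j => sqnorm (G j - 0)))).
  by rewrite (expectation_sqnorm_shift G 0 unif) lerDl sqnorm_ge0.
rewrite -[leRHS](expectation_cst unif); apply: (le_expectation unif) => j _.
by rewrite subr0 -le_enorm.
Qed.

(** A full batch has no sampling error; a sampled batch of size [S] averages
    [S] independent draws, which divides the variance by [S]. *)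
Lemma draw_batch_estimates (prm : qfw_params R) n i k (G : 'I_n -> 'rV[R]_d)
    B V : (0 < n)%N -> (forall j, `|G j| <= B) -> 0 <= V ->
  (k != 1%N -> (forall j, enorm (G j) <= B) /\
    B ^+ 2 / (roundup (sample_size prm i k))%:R <= V) ->
  estimates (fun js => `|(size js)%:R^-1 *: \sum_(j <- js) G j| <= B)
    (draw_batch prm n i k) (fun js => (size js)%:R^-1 *: \sum_(j <- js) G j)
    (n%:R^-1 *: \sum_j G j) V.
Proof.
move=> n0 GB V0; rewrite /draw_batch.
have avgB js : (0 < size js)%N -> `|(size js)%:R^-1 *: \sum_(j <- js) G j| <= B.
  move=> js0; rewrite normrZ ger0_norm ?invr_ge0// mulrC ler_pdivrMr ?ltr0n//.
  rewrite (le_trans (ler_norm_sum _ _ _))// -sum1_size natr_sum mulr_sumr.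
  by apply: ler_sum => j _; rewrite mulr1.
have [_ _|_ /(_ isT)[GBe SV]] := eqVneq k 1%N.
  rewrite (_ : n%:R^-1 *: _ =
      (size (enum 'I_n))%:R^-1 *: \sum_(j <- enum 'I_n) G j); last first.
    by rewrite size_enum_ord big_enum.
  apply: estimates_weaken (fun _ h => h) V0 _.
  by apply: estimates_ret; apply: avgB; rewrite size_enum_ord.
set S := roundup _ in SV *; have S0 : (0 < S)%N by exact: roundup_gt0.
have S0R : S%:R != 0 :> R by rewrite pnatr_eq0 -lt0n.
have := @estimates_independent R d _ _ (fun=> True) (nseq S tt)
  (fun=> uniform R 'I_n) G (fun=> n%:R^-1 *: \sum_j G j) (B ^+ 2) B
  (fun=> uniform_estimates n0 GBe) (fun j _ => GB j).
rewrite map_nseq size_nseq => /(estimatesZ S%:R^-1).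
rewrite big_const_seq count_predT size_nseq iter_addr_0.
rewrite -(scaler_nat S (_ *: _)) scalerA mulVf// scale1r => /eq_estimates.
move=> /(_ (fun js => (size js)%:R^-1 *: \sum_(j <- js) G j)) H.
apply: estimates_weaken (H _).
- by move=> js [js1 _]; apply: avgB; rewrite js1.
- by apply: le_trans SV; rewrite le_eqVlt; apply/orP; left; apply/eqP; field.
- by move=> js [-> _].
Qed.

Definition increment (k : nat) (f : 'rV[R]_d -> R) (x xprev : 'rV[R]_d) :=
  if k == 1%N then grad f x else grad f x - grad f xprev.

Lemma increment_batch_average n (F : 'I_n -> 'rV[R]_d -> R) js k x xprev :
  (forall j, differentiable (F j) x) ->
  (forall j, differentiable (F j) xprev) ->
  increment k (batch_average F js) x xprev
  = (size js)%:R^-1 *: \sum_(j <- js) increment k (F j) x xprev.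
Proof.
move=> dx dx'; rewrite /increment.
have [_ ->] := differentiable_batch_average js dx.
have [_ ->] := differentiable_batch_average js dx'.
by case: eqP => // _; rewrite -scalerBr -sumrB.
Qed.

Lemma worker_round_estimates (prm : qfw_params R) n
    (F : 'I_n -> 'rV[R]_d -> R) i k x xprev B V c :
  (0 < n)%N ->
  (forall j, differentiable (F j) x) ->
  (forall j, differentiable (F j) xprev) ->
  (forall j, `|increment k (F j) x xprev| <= B) -> 0 <= V ->
  (k != 1%N -> (forall j, enorm (increment k (F j) x xprev) <= B) /\
    B ^+ 2 / (roundup (sample_size prm i k))%:R <= V) ->
  d%:R / (roundup (level1 prm i k))%:R ^+ 2 <= c ->
  estimates (fun msg => `|decode msg| <= B) (worker_round prm F i k x xprev)
    (@decode R d) (increment k (batch_average F (enum 'I_n)) x xprev)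
    (c * B ^+ 2 + V).
Proof.
move=> n0 dx dx' GB V0 GV sc; rewrite /worker_round.
have B0 : 0 <= B by rewrite (le_trans _ (GB (Ordinal n0))).
have := draw_batch_estimates n0 GB V0 GV.
rewrite increment_batch_average// size_enum_ord big_enum.
move=> /estimates_bind; apply => js avgB.
rewrite -/(increment k _ x xprev) increment_batch_average//.
have := encode_estimates
  ((size js)%:R^-1 *: \sum_(j <- js) increment k (F j) x xprev)
  (roundup_gt0 (level1 prm i k)).
apply: estimates_weaken => [msg h|]; first exact: le_trans h avgB.
by apply: ler_pM; rewrite ?divr_ge0 ?exprn_ge0// ler_pXn2r ?nnegrE.
Qed.

Definition broadcast (prm : qfw_params R) M n
    (F : 'I_M -> 'I_n -> 'rV[R]_d -> R) i k x xprev : fdist R (message R d) :=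
  dbind (independent
           [seq worker_round prm (F m) i k x xprev | m <- enum 'I_M])
    (fun msgs => encode (roundup (level2 prm i k))
       (M%:R^-1 *: \sum_(msg <- msgs) decode msg)).

(** Three sources of noise contribute [B^2 / q] each: sampling with at least
    [q / M] draws per worker and the upload with variance factor at most
    [M / q] are averaged over [M] independent workers, and the broadcast has
    variance factor at most [1 / q].  The last bound is relative to the sup norm
    of the averaged messages, still at most [B] since decoding never increases
    it. *)
Lemma broadcast_estimates (prm : qfw_params R) M n
    (F : 'I_M -> 'I_n -> 'rV[R]_d -> R) i k x xprev B q :
  (0 < M)%N -> (0 < n)%N -> 0 < q ->
  (forall m j, differentiable (F m j) x) ->
  (forall m j, differentiable (F m j) xprev) ->
  (forall m j, `|increment k (F m j) x xprev| <= B) ->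
  (k != 1%N -> (forall m j, enorm (increment k (F m j) x xprev) <= B) /\
    q / M%:R <= sample_size prm i k) ->
  level1 prm i k = Num.sqrt (d%:R * (q / M%:R)) ->
  level2 prm i k = Num.sqrt (d%:R * q) ->
  estimates (fun=> True) (broadcast prm F i k x xprev) (@decode R d)
    (increment k (objective F) x xprev) (3 * B ^+ 2 / q).
Proof.
move=> M0 n0 q0 dx dx' GB GS l1 l2.
have M0R : 0 < M%:R :> R by rewrite ltr0n.
have M0R' : M%:R != 0 :> R by rewrite gt_eqF.
have qM : 0 < q / M%:R by rewrite divr_gt0.
have B0 : 0 <= B by rewrite (le_trans _ (GB (Ordinal M0) (Ordinal n0))).
have workers m : estimates (fun msg => `|decode msg| <= B)
    (worker_round prm (F m) i k x xprev) (@decode R d)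
    (increment k (batch_average (F m) (enum 'I_n)) x xprev)
    ((q / M%:R)^-1 * B ^+ 2 + B ^+ 2 / (q / M%:R)).
  apply: worker_round_estimates => //.
  - by rewrite divr_ge0 ?sqr_ge0// ltW.
  - move=> /GS[GBe qS]; split => //.
    rewrite ler_wpM2l ?sqr_ge0// lef_pV2 ?posrE ?ltr0n ?roundup_gt0//.
    by rewrite (le_trans qS)// roundup_ge.
  - by rewrite l1; exact: level_variance.
have := estimates_independent (enum 'I_M) workers (fun _ h => h).
rewrite size_enum_ord => /(estimatesZ M%:R^-1)/estimates_bind.
have db x' m : (forall m j, differentiable (F m j) x') ->
    differentiable (batch_average (F m) (enum 'I_n)) x'.
  by move=> dF; have [] := differentiable_batch_average (enum 'I_n) (dF m).
rewrite objectiveE increment_batch_average ?size_enum_ord; first last.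
- by move=> m; exact: db.
- by move=> m; exact: db.
move=> /(_ _ (fun=> True) (fun msgs => encode (roundup (level2 prm i k))
  (M%:R^-1 *: \sum_(msg <- msgs) decode msg)) (@decode R d) (q^-1 * B ^+ 2)) H.
apply: estimates_weaken (H _) => // [|msgs [_ msgsB]].
  by rewrite le_eqVlt; apply/orP; left; apply/eqP; field; rewrite M0R' gt_eqF.
have := encode_estimates (M%:R^-1 *: \sum_(msg <- msgs) decode msg)
  (roundup_gt0 (level2 prm i k)).
apply: estimates_weaken => //; apply: ler_pM; rewrite ?divr_ge0 ?exprn_ge0//.
  by rewrite l2; exact: level_variance.
rewrite ler_pXn2r ?nnegrE// normrZ ger0_norm ?invr_ge0//.
by rewrite mulrC ler_pdivrMr// mulrC.
Qed.

Lemma qfw_roundE (prm : qfw_params R) M n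
    (F : 'I_M -> 'I_n -> 'rV[R]_d -> R) (lmo : oracle R d) i k h :
  qfw_round prm F lmo i k h =
  let x := iterate h in
  let: (xprev, gprev) := head (x, 0) (past h) in
  dbind (broadcast prm F i k x xprev) (fun msg =>
    let gbar := if k == 1%N then decode msg else decode msg + gprev in
    dret R (Transcript (x + step_size prm i k *: (lmo h gbar - x))
                       ((x, gbar) :: past h))).
Proof.
by rewrite /qfw_round /=; case: (head _ _) => xprev gprev; rewrite -dbindA.
Qed.

End Rounds.

(** * Convergence over the doubling periods *)

Lemma round_indexS p t :
  round_index p t.+2 = next_index p (round_index p t.+1).
Proof. by []. Qed.

Lemma doubling_period_gt0 i : (0 < doubling_period i)%N.
Proof. by rewrite expn_gt0. Qed.

(** The periods before the [i]-th have total length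
    [1 + 2 + ... + 2^(i - 2) = 2^(i - 1) - 1]. *)
Lemma round_index_doubling t :
  let: (i, k) := round_index doubling_period t.+1 in
  [/\ (0 < i)%N, (0 < k)%N, (k <= doubling_period i)%N &
      (doubling_period i + k = t.+2)%N].
Proof.
elim: t => [//|t]; rewrite round_indexS.
case: (round_index _ _) => i k /= [i0 k0 kp pk]; rewrite /next_index /=.
case: ltnP => [kp'|pk']; first by split => //; rewrite addnS pk.
have kE : k = doubling_period i by apply/eqP; rewrite eqn_leq kp.
split => //; first exact: doubling_period_gt0.
by rewrite addn1 -pk kE /doubling_period /= -{1}(prednK i0) expnS mul2n -addnn.
Qed.

Section Convergence.
Context {R : realType} {d M n : nat}.
Variables (L D G : R) (K : set 'rV[R]_d) (F : 'I_M -> 'I_n -> 'rV[R]_d -> R).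
Variables (lmo : oracle R d) (x1 : 'rV[R]_d).
Hypotheses (M0 : (0 < M)%N) (n0 : (0 < n)%N) (L0 : 0 <= L) (D0 : 0 <= D).
Hypothesis convK : @convex_set R 'rV[R]_d K.
Hypothesis diamK : forall x y, K x -> K y -> enorm (x - y) <= D.
Hypothesis convF : forall m j, convex_along K (F m j).
Hypothesis smoothF : forall m j, smooth_on L K (F m j).
Hypothesis gradF : forall m j x, K x -> `|grad (F m j) x| <= G.
Hypothesis lmoK : linear_minimization_oracle K lmo.
Hypothesis Kx1 : K x1.

Let f := objective F.
Let prm := doubling_params R d M.

Let smoothf : smooth_on L K f.
Proof.
rewrite /f objectiveE.
apply: smooth_batch_average => [|m]; rewrite ?size_enum_ord//.
by apply: smooth_batch_average => //; rewrite size_enum_ord.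
Qed.

Let convf : convex_along K f.
Proof. by rewrite /f objectiveE; do 2 apply: convex_batch_average => ?. Qed.

(** Minimizing along [g] instead of the gradient costs the inner product of the
    error with [u - v], at most [D] times its norm [e].  The bound
    [e <= p / 2 * e^2 + 1 / (2 p)] turns this into the mean square error, which
    is what the unbiased estimates control; it loses nothing at [e = 1 / p],
    the true order of the error. *)
Lemma frank_wolfe_step g v x u eta p :
  argmin_linear K g v -> K x -> K u -> 0 <= eta <= 1 -> 0 < p ->
  f (x + eta *: (v - x)) - f u <= (1 - eta) * (f x - f u)
    + eta * D * (p / 2 * sqnorm (g - grad f x) + (2 * p)^-1)
    + L * D ^+ 2 * eta ^+ 2.
Proof.
move=> [Kv vmin] Kx Ku eta01 p0; have /andP[eta0 eta1] := eta01.
have := smooth_segment convK L0 smoothf Kx Kv eta01.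
rewrite ler_norml => /andP[_ hs].
have hc := convex_gradient_le convK L0 smoothf convf Kx Ku.
have sqD : L * eta ^+ 2 * sqnorm (v - x) <= L * eta ^+ 2 * D ^+ 2.
  by rewrite ler_wpM2l ?mulr_ge0 ?sqr_ge0// -le_enorm// diamK.
set e := enorm (g - grad f x).
have eE : sqnorm (g - grad f x) = e ^+ 2 by rewrite enorm_sqr.
have e0 : 0 <= e by exact: enorm_ge0.
have hn : dotp (g - grad f x) (u - v) <= e * D.
  by rewrite (le_trans (cauchy_schwarz _ _))// ler_wpM2l// diamK.
have hv := vmin u Ku.
have amgm : e <= p / 2 * e ^+ 2 + (2 * p)^-1.
  rewrite -subr_ge0.
  rewrite [X in 0 <= X](_ : _ = (p * e - 1) ^+ 2 / (2 * p)); last first.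
    by field; rewrite gt_eqF.
  by rewrite divr_ge0 ?sqr_ge0// mulr_ge0// ltW.
have eD : e * D <= D * (p / 2 * e ^+ 2 + (2 * p)^-1).
  by rewrite mulrC ler_wpM2l.
have main : dotp (grad f x) (v - x)
    <= D * (p / 2 * e ^+ 2 + (2 * p)^-1) + (f u - f x).
  move: hn hc; rewrite !dotpBl !dotpBr !(dotpC g) => hn hc; lra.
have := ler_wpM2l eta0 main; rewrite eE; lra.
Qed.

Definition estimate_error (h : transcript R d) : R :=
  let: (xprev, gprev) := head (iterate h, 0) (past h) in
  sqnorm (gprev - grad f xprev).

(** After [t] rounds the last move was a step of size [2 / (t + 1)] inside [K].
    Before the first round the previous point defaults to the current one, so
    the initial transcript qualifies. *)
Definition on_track (t : nat) (h : transcript R d) : Prop :=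
  let: (xprev, gprev) := head (iterate h, 0) (past h) in
  [/\ K (iterate h), K xprev &
      enorm (iterate h - xprev) <= 2 / t.+1%:R * D].

Let diffF m j x : K x -> differentiable (F m j) x.
Proof. by case: (smoothF m j) => + _; apply. Qed.

(** In the first round of a period the encoded vectors are gradients, bounded by
    [G].  Later ones are gradient differences over a move of length at most
    [2 D / p], since the preceding round belongs to the same period and has
    number at least [p]; so [B = 2 L D / p], and [3 B^2 / p] is the bound. *)
Lemma broadcast_on_track t h :
  on_track t h ->
  let: (i, k) := round_index doubling_period t.+1 in
  let p : R := (doubling_period i)%:R in
  let: (xprev, gprev) := head (iterate h, 0) (past h) in
  estimates (fun=> True) (broadcast prm F i k (iterate h) xprev) (@decode R d)
    (increment k f (iterate h) xprev)
    (if k == 1%N then 3 * G ^+ 2 / p ^+ 2 else 12 * (L * D) ^+ 2 / p ^+ 3).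
Proof.
have := round_index_doubling t.
case: (round_index _ _) => i k [i0 k0 kp pk].
rewrite /on_track; case: (head _ _) => xprev gprev [Kx Kxp xxp].
set p : R := (doubling_period i)%:R.
have p0 : 0 < p by rewrite ltr0n doubling_period_gt0.
have MR : M%:R != 0 :> R by rewrite pnatr_eq0 -lt0n.
have pn0 := lt0r_neq0 p0.
have [k1|k1] := eqVneq k 1%N.
  apply: (@broadcast_estimates _ _ _ _ _ _ _ _ _ _ G (p ^+ 2)) => //.
  - by rewrite exprn_gt0.
  - by move=> m j; exact: diffF.
  - by move=> m j; exact: diffF.
  - by move=> m j; rewrite /increment k1 /=; exact: gradF.
  - by rewrite k1.
  - by rewrite /= k1 /= mulrA.
  - by rewrite /= k1.
have step : 2 / t.+1%:R * D <= 2 / p * D.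
  rewrite ler_wpM2r// ler_wpM2l// lef_pV2 ?posrE ?ltr0n ?doubling_period_gt0//.
  by rewrite ler_nat; lia.
have incB m j :
    enorm (increment k (F m j) (iterate h) xprev) <= L * (2 / p * D).
  rewrite /increment (negbTE k1); case: (smoothF m j) => _ /(_ _ _ Kx Kxp) h'.
  by rewrite (le_trans h')// ler_wpM2l// (le_trans xxp).
rewrite [X in estimates _ _ _ _ X](_ : _ = 3 * (L * (2 / p * D)) ^+ 2 / p);
  last by field.
apply: broadcast_estimates => //.
- by move=> m j; exact: diffF.
- by move=> m j; exact: diffF.
- by move=> m j; rewrite (le_trans (norm_le_enorm _)).
- by rewrite /= (negbTE k1) mulrA.
- by rewrite /= (negbTE k1).
Qed.

(** The fresh noise is centred given the past, so its variance is added to the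
    squared error carried over within a period; a new period discards that
    error.  The suboptimality bound is [frank_wolfe_step] in expectation. *)
Lemma qfw_round_on_track t h u : on_track t h -> K u ->
  let: (i, k) := round_index doubling_period t.+1 in
  let p : R := (doubling_period i)%:R in
  let eta : R := 2 / t.+2%:R in
  let round := qfw_round prm F lmo i k h in
  [/\ law_on (on_track t.+1) round,
      expectation round estimate_error <=
        (if k == 1%N then 3 * G ^+ 2 / p ^+ 2
         else estimate_error h + 12 * (L * D) ^+ 2 / p ^+ 3) &
      expectation round (fun h' => f (iterate h') - f u) <=
        (1 - eta) * (f (iterate h) - f u)
        + eta * D * (p / 2 * expectation round estimate_error + (2 * p)^-1)
        + L * D ^+ 2 * eta ^+ 2].
Proof.
move=> track Ku; have := broadcast_on_track track.
have := round_index_doubling t.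
case: (round_index _ _) => i k [i0 k0 kp pk].
have := qfw_roundE prm F lmo i k h.
move: track; rewrite {1}/on_track [estimate_error h]/estimate_error /=.
case: (head (iterate h, 0) (past h)) => xprev gprev [Kx Kxp xxp].
set p : R := (doubling_period i)%:R; set x := iterate h.
have etaE : 2 / (p + k%:R) = 2 / t.+2%:R by rewrite -natrD pk.
rewrite !etaE; set eta : R := 2 / _.
have p0 : 0 < p by rewrite ltr0n doubling_period_gt0.
have eta01 : 0 <= eta <= 1.
  by rewrite divr_ge0//= ler_pdivrMr ?ltr0n// mul1r ler_nat.
have /andP[eta0 eta1] := eta01.
pose gbar msg := if k == 1%N then decode msg else decode msg + gprev.
pose next msg := Transcript (x + eta *: (lmo h (gbar msg) - x))
                       ((x, gbar msg) :: past h).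
set b := broadcast _ _ _ _ _ _.
move=> roundE [bP bg bV].
have {}roundE :
    qfw_round prm F lmo i k h = dbind b (fun msg => dret R (next msg)).
  exact: roundE.
have expE phi : expectation (qfw_round prm F lmo i k h) phi
    = expectation b (fun msg => phi (next msg)).
  rewrite roundE expectation_bind; congr expectation; apply/funext => msg.
  exact: expectation_ret.
rewrite !expE.
split.
- rewrite roundE; apply: law_bind bP _ => msg _; apply: law_ret.
  rewrite /on_track /=.
  have [Kv _] := lmoK h (gbar msg).
  split => //; first exact: convex_set_segment.
  rewrite addrAC subrr add0r enormZ ger0_norm// ler_wpM2l//.
  exact: diamK.
- rewrite /estimate_error /next /gbar /=; case: eqP bg bV => [k1|k1] bg bV.
    by rewrite /increment k1 /= in bV.
  (* The new error is the increment estimate compared with a point whose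
     distance to the true increment is the old error. *)
  under [X in expectation _ X]funext => msg.
    rewrite -addrA -[gprev - _]opprB; over.
  rewrite (expectation_sqnorm_shift _ _ bP) bg addrC; apply: lerD => //.
  by rewrite /increment (introF eqP k1) opprB addrC subrKA.
- pose Y msg := (1 - eta) * (f x - f u)
    + eta * D * (p / 2 * sqnorm (gbar msg - grad f x) + (2 * p)^-1)
    + L * D ^+ 2 * eta ^+ 2.
  apply: (@le_trans _ _ (expectation b Y)).
    apply: (le_expectation bP) => msg _.
    by apply: frank_wolfe_step => //; exact: lmoK.
  rewrite /Y !expectationD !expectationZ !expectationD !expectationZ.
  by rewrite !(expectation_cst bP).
Qed.

Let run := qfw prm F lmo x1.

Lemma qfwS t : run t.+1 = dbind (run t)
  (fun h => let: (i, k) := round_index doubling_period t.+1 in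
            qfw_round prm F lmo i k h).
Proof. by []. Qed.

Lemma qfw_on_track t : law_on (on_track t) (run t).
Proof.
elim: t => [|t IH].
  apply: law_ret; split => //=; rewrite subrr enorm0 mulr_ge0// divr_ge0//.
rewrite qfwS; apply: law_bind IH _ => h track.
have := qfw_round_on_track track Kx1.
by case: (round_index _ _) => i k [].
Qed.

(** The first round of the period leaves an error of order [1 / p^2], and each
    later one adds a term of order [1 / p^3]; as [k <= p], the total stays of
    order [1 / p^2]. *)
Lemma qfw_estimate_error t :
  let: (i, k) := round_index doubling_period t.+1 in
  let p : R := (doubling_period i)%:R in
  expectation (run t.+1) estimate_error
  <= 3 * G ^+ 2 / p ^+ 2 + 12 * (L * D) ^+ 2 * k%:R / p ^+ 3.
Proof.
have step s : let: (i, k) := round_index doubling_period s.+1 in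
    let p : R := (doubling_period i)%:R in
    expectation (run s.+1) estimate_error <=
    if k == 1%N then 3 * G ^+ 2 / p ^+ 2
    else expectation (run s) estimate_error + 12 * (L * D) ^+ 2 / p ^+ 3.
  rewrite qfwS expectation_bind.
  have track h : on_track s h -> _ := fun H => qfw_round_on_track H Kx1.
  move: track; case: (round_index _ _) => i k track /=.
  have := qfw_on_track s => sP; case: ifP => k1.
    rewrite -[leRHS](expectation_cst sP).
    by apply: (le_expectation sP) => h /track; rewrite k1 => -[].
  rewrite -[X in _ <= _ + X](expectation_cst sP) -expectationD.
  by apply: (le_expectation sP) => h /track; rewrite k1 => -[].
have q0 i : 0 <= 12 * (L * D) ^+ 2 / (doubling_period i)%:R ^+ 3.
  by rewrite divr_ge0 ?exprn_ge0// mulr_ge0// sqr_ge0.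
elim: t => [|t].
  have /= := step 0; rewrite /doubling_period /= expn0 => h.
  apply: le_trans h _; rewrite lerDl.
  by have := q0 0%N; rewrite /doubling_period /= expn0 mulr1.
have := step t.+1; have := round_index_doubling t.
rewrite round_indexS; case: (round_index _ t.+1) => i k [i0 k0 kp pk].
rewrite /next_index /=; case: ifP => kp'.
  rewrite eqSS (gtn_eqF k0) => h IH; apply: le_trans h _.
  rewrite -[in leRHS]natr1; apply: le_trans (lerD IH (lexx _)) _.
  rewrite le_eqVlt; apply/orP; left; apply/eqP; ring.
move=> h _; apply: le_trans h _.
by rewrite lerDl mulr1.
Qed.

(** With [tau = t + 2] the recurrence is [e' <= (1 - 2 / tau) e + A / tau^2],
    which preserves the bound [A / tau].  The first step has size 1, so the
    quality of the starting point is forgotten at once. *)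
Lemma qfw_suboptimality t u : K u ->
  expectation (run t.+1) (fun h => f (iterate h) - f u)
  <= (2 * D * (3 * G ^+ 2 + 12 * (L * D) ^+ 2 + 1) + 4 * L * D ^+ 2) / t.+2%:R.
Proof.
move=> Ku; set c := 3 * G ^+ 2 + 12 * (L * D) ^+ 2.
set A := 2 * D * _ + _.
have c0 : 0 <= c by rewrite addr_ge0// mulr_ge0// sqr_ge0.
have A0 : 0 <= A.
  by rewrite addr_ge0// !mulr_ge0// ?sqr_ge0// addr_ge0.
have step s : let eta : R := 2 / s.+2%:R in
    expectation (run s.+1) (fun h => f (iterate h) - f u) <=
    (1 - eta) * expectation (run s) (fun h => f (iterate h) - f u)
    + A / s.+2%:R ^+ 2.
  move=> eta; have err := qfw_estimate_error s.
  have track h : on_track s h -> _ := fun H => qfw_round_on_track H Ku.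
  have sP := qfw_on_track s.
  have := round_index_doubling s.
  move: err track (qfwS s); case: (round_index _ s.+1) => i k.
  move=> err track qfwSs [i0 k0 kp pk].
  set p : R := (doubling_period i)%:R in err track.
  have p0 : 0 < p by rewrite ltr0n doubling_period_gt0.
  have pn0 := lt0r_neq0 p0.
  have errp : expectation (run s.+1) estimate_error <= c / p ^+ 2.
    apply: le_trans err _.
    rewrite /c (mulrDl (3 * G ^+ 2)) lerD2l ler_pdivrMr ?exprn_gt0//.
    rewrite [leRHS](_ : _ = 12 * (L * D) ^+ 2 * p); last by field.
    by rewrite ler_wpM2l ?ler_nat// mulr_ge0// sqr_ge0.
  have eta0 : 0 <= eta by rewrite divr_ge0.
  have etap : p^-1 <= eta.
    rewrite -[leLHS]mul1r ler_pdivrMr// mulrAC ler_pdivlMr ?ltr0n// mul1r.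
    by rewrite -natrM ler_nat; lia.
  apply: (@le_trans _ _ (
      (1 - eta) * expectation (run s) (fun h => f (iterate h) - f u)
      + eta * D * (p / 2 * expectation (run s.+1) estimate_error + (2 * p)^-1)
      + L * D ^+ 2 * eta ^+ 2)).
    pose e h := expectation (qfw_round prm F lmo i k h) estimate_error.
    pose Y h := (1 - eta) * (f (iterate h) - f u)
      + eta * D * (p / 2 * e h + (2 * p)^-1) + L * D ^+ 2 * eta ^+ 2.
    apply: (@le_trans _ _ (expectation (run s) Y)).
      rewrite qfwSs expectation_bind; apply: (le_expectation sP) => h /track.
      by case.
    rewrite /Y !expectationD !expectationZ !expectationD !expectationZ.
    by rewrite !(expectation_cst sP) qfwSs expectation_bind.
  rewrite -addrA lerD2l.
  apply: (@le_trans _ _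
      (eta * D * ((c + 1) / 2 * eta) + L * D ^+ 2 * eta ^+ 2)).
    rewrite lerD2r ler_wpM2l ?mulr_ge0//.
    apply: (@le_trans _ _ ((c + 1) / 2 * p^-1)); last first.
      by rewrite ler_wpM2l// divr_ge0// addr_ge0.
    rewrite [leRHS](_ : _ = p / 2 * (c / p ^+ 2) + (2 * p)^-1); last by field.
    by rewrite lerD2r ler_wpM2l// divr_ge0// ltW.
  have tau0 : s.+2%:R != 0 :> R by rewrite pnatr_eq0.
  rewrite /A /eta; move: (s.+2%:R : R) tau0 => tau tau0.
  by rewrite le_eqVlt; apply/orP; left; apply/eqP; field.
elim: t => [|t IH].
  have /= := step 0%N; rewrite divff ?pnatr_eq0// subrr mul0r add0r => h.
  apply: le_trans h _; rewrite ler_wpM2l// lef_pV2 ?posrE// ?exprn_gt0//.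
  by rewrite -natrX ler_nat.
have := step t.+1; rewrite /= => h; apply: le_trans h _.
set tau : R := t.+3%:R.
have tauE : t.+2%:R = tau - 1 :> R by rewrite /tau -[t.+3%:R]natr1 addrK.
have tau2 : 2 < tau by rewrite ltr_nat.
have eta1 : 0 <= 1 - 2 / tau.
  by rewrite subr_ge0 ler_pdivrMr ?mul1r ?ltW//; lra.
have := ler_wpM2l eta1 IH; rewrite tauE => h.
apply: le_trans (lerD h (lexx _)) _; rewrite -subr_ge0.
rewrite [X in 0 <= X](_ : _ = A / (tau ^+ 2 * (tau - 1))); last first.
  by field; apply/andP; split; lra.
by rewrite divr_ge0// mulr_ge0 ?sqr_ge0//; lra.
Qed.

End Convergence.

(** * Cost and conclusion *)

(** The period number counts the full batches.  In any other round the sampled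
    batch has size [p / M] with [p] at most the round number, so these batches
    add up to a quadratic bound. *)
Lemma ifo_complexity_le (R : realType) d M n t :
  let: (i, k) := round_index doubling_period t.+1 in
  ifo_complexity (doubling_params R d M) n t.+1
  <= n%:R * i%:R + 2 * t.+1%:R ^+ 2 / M%:R.
Proof.
have ifoS s : ifo_complexity (doubling_params R d M) n s.+1 =
   ifo_complexity (doubling_params R d M) n s +
   (let: (i, k) := round_index doubling_period s.+1 in
    if k == 1%N then n%:R else 2 * ((doubling_period i)%:R / M%:R)).
  by rewrite /ifo_complexity big_nat_recr.
elim: t => [|t].
  by rewrite ifoS /ifo_complexity big_geq//= add0r mulr1 lerDl divr_ge0.
rewrite [in X in _ -> X]ifoS.
have := round_index_doubling t; rewrite round_indexS.
case: (round_index _ t.+1) => i k [i0 k0 kp pk]; rewrite /next_index /= => IH.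
have sq : t.+2%:R ^+ 2 = t.+1%:R ^+ 2 + t.+1%:R + t.+2%:R :> R.
  by rewrite -[t.+2%:R]natr1; ring.
have sqM : 2 * t.+1%:R ^+ 2 / M%:R <= 2 * t.+2%:R ^+ 2 / M%:R :> R.
  by rewrite ler_wpM2r ?invr_ge0// ler_wpM2l// -!natrX ler_nat leq_sqr.
case: ifP => kp' /=.
  rewrite eqSS (gtn_eqF k0); apply: le_trans (lerD IH (lexx _)) _.
  rewrite -addrA lerD2l mulrA -mulrDl ler_wpM2r ?invr_ge0// -mulrDr ler_wpM2l//.
  rewrite sq -addrA lerD2l -natrD ler_nat; lia.
apply: le_trans (lerD IH (lexx _)) _.
rewrite -[in leRHS]natr1 mulrDr mulr1 addrAC; apply: lerD => //.
Qed.

Theorem corollary4p3p1 (R : realType) (L D Ginf : R) :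
  exists C eps0 : R, [/\ 0 < C, 0 < eps0 &
    forall eps : R, 0 < eps -> eps <= eps0 ->
    exists T : nat, [/\ (0 < T)%N, T%:R <= C / eps &
      forall (M n d : nat) (K : set 'rV[R]_d)
        (F : 'I_M -> 'I_n -> 'rV[R]_d -> R) (lmo : oracle R d) (x1 : 'rV[R]_d),
      (0 < M)%N -> (0 < n)%N ->
      compact K -> @convex_set R 'rV[R]_d K -> diameter K = D ->
      (forall m j, @convex_function R 'rV[R]_d K (F m j)) ->
      (forall m j, smooth_on L K (F m j)) ->
      (forall m j x, K x -> `|grad (F m j) x| <= Ginf) ->
      linear_minimization_oracle K lmo ->
      K x1 ->
      let prm := doubling_params R d M in
      let f := objective F in
      expectation (qfw prm F lmo x1 T) (fun h => f (iterate h))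
        - inf [set f x | x in K] <= eps /\
      ifo_complexity prm n T <=
        C * (((M * n)%:R * ln (1 / eps) + 1 / eps ^+ 2) / M%:R)]].
Proof.
(* The constants are chosen before any instance is given, when nothing is known
   about the signs of [L] and [D]. *)
set A := 2 * `|D| * (3 * Ginf ^+ 2 + 12 * (`|L| * `|D|) ^+ 2 + 1)
  + 4 * `|L| * `|D| ^+ 2.
have A0 : 0 <= A.
  by rewrite addr_ge0// !mulr_ge0// ?sqr_ge0// !addr_ge0// mulr_ge0// sqr_ge0.
have A1 : 1 <= A + 1 by rewrite lerDr.
have ln2 : 0 < ln 2 :> R by rewrite ln_gt0// ltr1n.
pose C1 : R := 1 + (ln (A + 1) + 1) / ln 2.
have C10 : 0 <= C1.
  by rewrite addr_ge0// divr_ge0 ?(ltW ln2)// addr_ge0// ln_ge0.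
pose C := C1 + 2 * (A + 1) ^+ 2 + (A + 1).
have C2 : 2 * (A + 1) ^+ 2 <= C by rewrite /C; lra.
have C0 : 0 < C.
  rewrite /C ltr_wpDl// ?(lt_le_trans ltr01)//.
  by rewrite addr_ge0// mulr_ge0// sqr_ge0.
exists C, (expR (- 1)); split; [exact: C0|exact: expR_gt0|move=> eps eps0 epse].
(* The threshold [exp (-1)] makes the logarithm at least 1, so that it absorbs
   additive constants. *)
have l1 : 1 <= ln (1 / eps).
  by rewrite div1r lnV ?posrE// lerNr -[leRHS]expRK ler_ln ?posrE ?expR_gt0//.
have eps1 : eps <= 1.
  by apply: le_trans epse _; rewrite -expR0 ler_expR; rewrite oppr_le0.
have Ae0 : 0 <= A / eps by rewrite divr_ge0// ltW.
have /andP[T1 T2] := truncn_itv Ae0.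
set t := Num.truncn (A / eps) in T1 T2.
have TA : t.+1%:R <= (A + 1) / eps.
  rewrite -natr1 mulrDl lerD// ler_pdivlMr// mul1r//.
exists t.+1; split => //.
  apply: le_trans TA _; rewrite ler_wpM2r ?invr_ge0 ?(ltW eps0)// lerDr.
  by rewrite addr_ge0// mulr_ge0// sqr_ge0.
move=> M n d K F lmo x1 M0 n0 cptK convK diamK convF smoothF gradF lmoK Kx1.
move=> prm f.
have diam x y : K x -> K y -> enorm (x - y) <= `|D|.
  move=> Kx Ky; apply: le_trans (ler_norm D).
  by rewrite -diamK; exact: enorm_le_diameter.
split.
  suff sub u : K u ->
      expectation (qfw prm F lmo x1 t.+1) (fun h => f (iterate h)) - eps <= f u.
    rewrite lerBlDr addrC -lerBlDr.
    apply: lb_le_inf; first by exists (f x1), x1.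
    by move=> _ [u Ku <-]; exact: sub.
  move=> Ku; rewrite lerBlDr addrC -lerBlDr.
  have smoothF' m j : smooth_on `|L| K (F m j).
    have [dF LF] := smoothF m j; split => // x y Kx Ky.
    apply: le_trans (LF x y Kx Ky) _.
    by rewrite ler_wpM2r ?enorm_ge0// ler_norm.
  have := @qfw_suboptimality R d M n `|L| `|D| Ginf K F lmo x1 M0 n0
    (normr_ge0 L) (normr_ge0 D) convK diam
    (fun m j => convex_function_along (convF m j))
    smoothF' gradF lmoK Kx1 t u Ku.
  have runP := @qfw_on_track R d M n `|L| `|D| Ginf K F lmo x1 M0 n0
    (normr_ge0 L) (normr_ge0 D) convK diam
    (fun m j => convex_function_along (convF m j))
    smoothF' gradF lmoK Kx1 t.+1.
  rewrite expectationD (expectation_cst runP) -/A => h; apply: le_trans h _.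
  rewrite ler_pdivrMr// mulrC -ler_pdivrMr//.
  by rewrite (le_trans (ltW T2))// ler_nat.
have := ifo_complexity_le R d M n t; have := round_index_doubling t.
case: (round_index _ _) => i k [i0 k0 kp pk] h; apply: le_trans h _.
have MR : 0 < M%:R :> R by rewrite ltr0n.
(* [2^(i - 1) <= T] bounds the number of periods by a logarithm of [T]. *)
have iC : i%:R <= C1 * ln (1 / eps).
  have pT : (doubling_period i <= t.+1)%N.
    by rewrite -ltnS -pk -[X in (X < _)%N]addn0 ltn_add2l.
  have : ln ((doubling_period i)%:R : R) <= ln (t.+1%:R).
    by rewrite ler_ln ?posrE ?ltr0n ?doubling_period_gt0// ler_nat.
  rewrite /doubling_period natrX lnXn// -[leLHS]mulr_natl => h.
  have ie0 : 0 < 1 / eps by rewrite divr_gt0.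
  have AE0 : 0 < A + 1 by exact: lt_le_trans A1.
  have lnT : ln t.+1%:R <= ln (A + 1) + ln (1 / eps).
    have -> : ln (A + 1) + ln (1 / eps) = ln ((A + 1) / eps).
      by rewrite [1 / eps]div1r lnM ?posrE// invr_gt0.
    by rewrite ler_ln ?posrE// divr_gt0.
  have iE : i%:R = 1 + i.-1%:R :> R.
    by rewrite -{1}(prednK i0) -[LHS]natr1 addrC.
  have lnA : ln (A + 1) <= ln (A + 1) * ln (1 / eps).
    by rewrite ler_peMr// ln_ge0.
  have i1 : i.-1%:R <= (ln (A + 1) + 1) * ln (1 / eps) / ln 2.
    by rewrite ler_pdivlMr// (le_trans h)// (le_trans lnT)//; lra.
  rewrite iE /C1 mulrDl mul1r lerD// mulrAC//.
have T2le : t.+1%:R ^+ 2 <= (A + 1) ^+ 2 / eps ^+ 2.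
  rewrite -expr_div_n ler_pXn2r// nnegrE// divr_ge0 ?(ltW eps0)//.
  exact: le_trans A1.
rewrite natrM [leRHS](_ : _ =
    n%:R * (C * ln (1 / eps)) + C / eps ^+ 2 / M%:R);
  last by field; rewrite ?gt_eqF.
apply: lerD.
  rewrite ler_wpM2l// (le_trans iC)// ler_wpM2r ?(le_trans ler01)//.
  rewrite /C -addrA lerDl addr_ge0 ?(le_trans ler01 A1)//.
  by rewrite mulr_ge0// sqr_ge0.
rewrite ler_wpM2r ?invr_ge0// (le_trans (ler_wpM2l (ler0n _ 2) T2le))//.
by rewrite mulrA ler_wpM2r ?invr_ge0 ?exprn_ge0 ?(ltW eps0).
Qed.
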